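(* Let $n\ge 1$, let $A\in M_{n,n}(\mathbb{R})$ and let $\vec{c}=(c_1,\ldots,c_n)\in\{-1,1\}^n$ with $c_1=1$. Then the matrix $\varphi_{\vec{c}}(A)$ is similar to $A$ and congruent to $A$, and $\varphi_{\vec{c}}(A)$ and $A$ have the same permanental polynomial.
   Context: $M_{n,n}(\mathbb{R})$ is the set of real $n\times n$ matrices. For $\vec{c}=(c_1,\ldots,c_n)\in\{-1,1\}^n$ with $c_1=1$, the map $\varphi_{\vec{c}}:M_{n,n}(\mathbb{R})\to M_{n,n}(\mathbb{R})$ is defined by $(\varphi_{\vec{c}}(A))_{ij}=c_i\,a_{ij}\,c_j$ for $A=(a_{ij})$. The permanental polynomial of $A$ is $q_A(\lambda)=\mathrm{perm}(A-\lambda I)$, where $\mathrm{perm}$ denotes the permanent. Similarity and congruence are over $\mathbb{R}$. *)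

(* Defs.v *)
From mathcomp Require Export all_boot all_order all_fingroup all_algebra.
From mathcomp Require Export reals.

Set Implicit Arguments.
Unset Strict Implicit.
Unset Printing Implicit Defensive.

Import GRing.Theory.
Local Open Scope ring_scope.

Definition permanent (R : comNzRingType) (n : nat) (A : 'M[R]_n) : R :=
  \sum_(s : 'S_n) \prod_(i < n) A i (s i).

(* As in [char_poly], the indeterminate lambda is ['X] and the entries of [A]
   are seen as constant polynomials; the sign is that of [A - lambda I]. *)
Definition permanental_poly (R : comNzRingType) (n : nat) (A : 'M[R]_n) :
    {poly R} :=
  permanent (map_mx (@polyC R) A - 'X%:M).

Definition sign_conj (R : comNzRingType) (n : nat) (c : 'rV[R]_n)
    (A : 'M[R]_n) : 'M[R]_n :=
  \matrix_(i, j) (c 0 i * A i j * c 0 j).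

Definition congruent_mx (R : comUnitRingType) (n : nat) (A B : 'M[R]_n) :
    Prop :=
  exists2 P : 'M[R]_n, P \in unitmx & B = P^T *m A *m P.

(* Main.v *)
Require Import Defs.

Import GRing.Theory.
Local Open Scope ring_scope.

(** Sign conjugation is [D *m A *m D] with [D = diag_mx c]. As the entries of [D] are signs, [D] is
    its own inverse, and being diagonal it is its own transpose; so [D] witnesses both similarity
    and congruence. The permanent is unchanged because each sign enters every product twice, and
    this carries over to the permanental polynomial. *)

Lemma sign_conjE (R : comNzRingType) (n : nat) (c : 'rV[R]_n) (A : 'M[R]_n) :
  sign_conj c A = diag_mx c *m A *m diag_mx c.
Proof. by apply/matrixP => i j; rewrite mul_mx_diag mul_diag_mx !mxE. Qed.

(* Along a permutation every sign occurs once as a row and once as a column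
   sign. *)
Lemma permanent_sign_conj (R : comNzRingType) (n : nat) (c : 'rV[R]_n)
    (A : 'M[R]_n) :
  (forall i, c 0 i * c 0 i = 1) -> permanent (sign_conj c A) = permanent A.
Proof.
move=> c2; apply: eq_bigr => s _.
under eq_bigr do rewrite mxE.
rewrite !big_split /= -(reindex_inj (P := xpredT) (F := c 0) (@perm_inj _ s)) /=.
by rewrite mulrAC -big_split /= big1 ?mul1r.
Qed.

(** Conjugation by signs fixes ['X%:M], so the matrix on the left is the sign conjugate of
    [A - 'X%:M] over [{poly R}], with the signs read as constant polynomials. *)
Lemma permanental_poly_sign_conj (R : comNzRingType) (n : nat) (c : 'rV[R]_n)
    (A : 'M[R]_n) :
  (forall i, c 0 i * c 0 i = 1) ->
  permanental_poly (sign_conj c A) = permanental_poly A.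
Proof.
move=> c2; have cP2 i : (c 0 i)%:P * (c 0 i)%:P = 1 by rewrite -polyCM c2.
have c2P i : map_mx polyC c 0 i * map_mx polyC c 0 i = 1 by rewrite mxE cP2.
rewrite /permanental_poly -[RHS](permanent_sign_conj _ _ _ _ c2P).
congr permanent; apply/matrixP => i j; rewrite !mxE !polyCM mulrBr mulrBl.
(* ['X] occurs only on the diagonal, where its two sign factors coincide and cancel. *)
case: eqVneq => [->|_]; last by rewrite mulr0n mulr0 mul0r.
by rewrite mulr1n [_ * 'X * _]mulrAC cP2 mul1r.
Qed.

Theorem theorem4 (R : realType) (n : nat) (hn : (0 < n)%N) (A : 'M[R]_n)
    (c : 'rV[R]_n) (hc : forall i : 'I_n, c 0 i = -1 \/ c 0 i = 1)
    (hc1 : c 0 (Ordinal hn) = 1) :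
  [/\ simmx_in unitmx (sign_conj c A) A,
      congruent_mx (sign_conj c A) A
    & permanental_poly (sign_conj c A) = permanental_poly A].
Proof.
have c2 i : c 0 i * c 0 i = 1 by case: (hc i) => ->; rewrite ?mulrNN mulr1.
have D2 : diag_mx c *m diag_mx c = 1%:M.
  by apply/matrixP => i j; rewrite mul_diag_mx !mxE mulrnAr c2.
have [Du _] := mulmx1_unit D2.
split; last exact: permanental_poly_sign_conj.
- exists (diag_mx c) => //; apply/simmxP => //.
  by rewrite sign_conjE !mulmxA D2 mul1mx.
(* The target is [A] itself: a second conjugation by the involution [diag_mx c] undoes the first. *)
- exists (diag_mx c) => //.
  by rewrite sign_conjE tr_diag_mx !mulmxA D2 mul1mx -mulmxA D2 mulmx1.
Qed.
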